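(* Let $X$ be a rack and let $A$ be an associative algebra, regarded as a trivial $X$-module. For $f_1\in CR^{p_1}(X,A)$ and $f_2\in CR^{p_2}(X,A)$ define $f_1\succ f_2,\ f_1\prec f_2\in CR^{p_1+p_2}(X,A)$ by $$(f_1 \succ f_2)(x_1,\dots,x_{p_1+p_2}) = \sum_{\sigma \in \mathrm{Sh}_{p_1,p_2}^{p_1+p_2}} \epsilon(\sigma)\, f_1(y_1,\dots,y_{p_1})\,f_2(z_1,\dots,z_{p_2}),$$ $$(f_1 \prec f_2)(x_1,\dots,x_{p_1+p_2}) = \sum_{\sigma \in \mathrm{Sh}_{p_1,p_2}^{p_1}} \epsilon(\sigma)\, f_1(y_1,\dots,y_{p_1})\,f_2(z_1,\dots,z_{p_2}),$$ where, for each $\sigma$, $$y_k = x_{i_1}\rhd\dots\rhd x_{i_j}\rhd x_{\sigma(k)}\quad(1\le k\le p_1),\qquad z_k = x_{\sigma(p_1+k)}\quad(1\le k\le p_2),$$ and, for each $k$, $i_1<\dots<i_j$ are all the elements of $\{\sigma(p_1+1),\dots,\sigma(p_1+p_2)\}$ that are smaller than $\sigma(k)$. Then the cochain complex $\{CR^n(X,A),d_R^n\}_{n\in\mathbb{N}}$ with the products $\succ$ and $\prec$ is a differential graded dendriform algebra. In particular, these products induce a graded dendriform algebra structure on the rack cohomology $HR^\bullet(X,A)$.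
   Context: A rack is a set $X$ with a binary operation $\rhd$ such that $x\rhd(y\rhd z)=(x\rhd y)\rhd(x\rhd z)$ for all $x,y,z$ and such that, for every $x$, the map $y\mapsto x\rhd y$ is a bijection of $X$. Iterated products are bracketed from the right: $x_1\rhd x_2\rhd\dots\rhd x_n = x_1\rhd(x_2\rhd(\cdots\rhd x_n))$; with no $i_l$ the product $x_{i_1}\rhd\dots\rhd x_{i_j}\rhd x_{\sigma(k)}$ is just $x_{\sigma(k)}$. $A$ is an associative algebra over a commutative ring; ''trivial $X$-module'' means $x\cdot a=a$. Rack cochain complex (trivial coefficients), $\mathbb{N}=\{0,1,2,\dots\}$: $CR^n(X,A)$ is the set of all maps $X^n\to A$, and $d_R^{n+1}:CR^n(X,A)\to CR^{n+1}(X,A)$ is $$d_R^{n+1}f=\sum_{i=1}^{n+1}(-1)^i\big(d_{i,0}^{n+1}f-d_{i,1}^{n+1}f\big),$$ $$(d_{i,0}^{n+1}f)(x_1,\dots,x_{n+1})=f(x_1,\dots,x_{i-1},x_i\rhd x_{i+1},\dots,x_i\rhd x_{n+1}),$$ $$(d_{i,1}^{n+1}f)(x_1,\dots,x_{n+1})=f(x_1,\dots,x_{i-1},x_{i+1},\dots,x_{n+1}).$$ $HR^\bullet(X,A)$ is its cohomology. $\mathrm{Sh}_{p_1,p_2}$ is the set of $(p_1,p_2)$-shuffles: permutations $\sigma$ of $\{1,\dots,p_1+p_2\}$ with $\sigma(1)<\dots<\sigma(p_1)$ and $\sigma(p_1+1)<\dots<\sigma(p_1+p_2)$; $\epsilon(\sigma)$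 is the sign. For $p_1,p_2\ge1$, $\mathrm{Sh}_{p_1,p_2}^{p_1}$ is the subset with $\sigma(p_1)=p_1+p_2$ and $\mathrm{Sh}_{p_1,p_2}^{p_1+p_2}$ the subset with $\sigma(p_1+p_2)=p_1+p_2$. Conventions when an index is $0$: if $p_1=0$ then $\mathrm{Sh}_{0,p_2}^{p_1+p_2}=\{\mathrm{id}\}$ and $\mathrm{Sh}_{0,p_2}^{p_1}=\emptyset$ (including $p_2=0$); if $p_1\ge1$ and $p_2=0$ then $\mathrm{Sh}_{p_1,0}^{p_1}=\{\mathrm{id}\}$ and $\mathrm{Sh}_{p_1,0}^{p_1+p_2}=\emptyset$. A graded dendriform algebra is a graded module $D$ with two degree-preserving linear maps $\succ,\prec:D\otimes D\to D$ satisfying for all $x,y,z$: $x\succ(y\succ z)=(x\succ y)\succ z+(x\prec y)\succ z$; $(x\succ y)\prec z=x\succ(y\prec z)$; $(x\prec y)\prec z=x\prec(y\prec z)+x\prec(y\succ z)$. It is a differential graded dendriform algebra if it carries a differential $d$ of degree $+1$ with $d(x\succ y)=(dx)\succ y+(-1)^{p}x\succ(dy)$ and $d(x\prec y)=(dx)\prec y+(-1)^{p}x\prec(dy)$ for $x$ of degree $p$. *)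

(* Defs.v *)
From HB Require Import structures.
From mathcomp Require Import all_boot all_order all_algebra all_fingroup.
From mathcomp Require Import generic_quotient ring_quotient.
From mathcomp Require Import boolp functions.

Set Implicit Arguments.
Unset Strict Implicit.
Unset Printing Implicit Defensive.
Import GRing.Theory.
Local Open Scope ring_scope.
Local Open Scope quotient_scope.

Record rack := Rack {
  rack_sort :> Type;
  rop : rack_sort -> rack_sort -> rack_sort;
  rop_selfdistr : forall x y z, rop x (rop y z) = rop (rop x y) (rop x z);
  rop_bij : forall x, bijective (rop x)
}.

Notation "x ▷ y" := (rop x y) (at level 40, y at level 40, no associativity).

(* MathComp's algType is unital; the algebras considered here need not be. *)
Record assocAlg (K : comPzRingType) := AssocAlg {
  assocAlg_sort :> lmodType K;
  amul : assocAlg_sort -> assocAlg_sort -> assocAlg_sort;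
  amulA : associative amul;
  amul_linearl : forall b, linear (fun a => amul a b);
  amul_linearr : forall a, linear (amul a)
}.

Section Graded.
Variables (K : comPzRingType) (D : nat -> lmodType K).

Definition gprod := forall p q, D p -> D q -> D (p + q)%N.

Definition gcast m n (e : m = n) (x : D m) : D n := ecast k (D k) e x.

(* A graded linear map D ⊗ D -> D is given by its bilinear components, and the
   identities are imposed on homogeneous elements. *)
Record is_graded_dendriform (succ prec : gprod) : Prop := IsGradedDendriform {
  succ_linearl : forall p q (y : D q), linear (fun x : D p => succ p q x y);
  succ_linearr : forall p q (x : D p), linear (succ p q x);
  prec_linearl : forall p q (y : D q), linear (fun x : D p => prec p q x y);
  prec_linearr : forall p q (x : D p), linear (prec p q x);
  succ_succ : forall p q r (x : D p) (y : D q) (z : D r),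
    gcast (addnA p q r) (succ _ _ x (succ _ _ y z)) =
      succ _ _ (succ _ _ x y) z + succ _ _ (prec _ _ x y) z;
  succ_prec : forall p q r (x : D p) (y : D q) (z : D r),
    prec _ _ (succ _ _ x y) z =
      gcast (addnA p q r) (succ _ _ x (prec _ _ y z));
  prec_prec : forall p q r (x : D p) (y : D q) (z : D r),
    prec _ _ (prec _ _ x y) z =
      gcast (addnA p q r) (prec _ _ x (prec _ _ y z) + prec _ _ x (succ _ _ y z))
}.

Variable d : forall n, {linear D n -> D n.+1}.

Definition leibniz (m : gprod) : Prop :=
  forall p q (x : D p) (y : D q),
    d _ (m _ _ x y) =
      m _ _ (d _ x) y + (-1) ^+ p *: gcast (addnS p q) (m _ _ x (d _ y)).

Record is_dg_dendriform (succ prec : gprod) : Prop := IsDGDendriform {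
  dg_dendriform : is_graded_dendriform succ prec;
  dg_square0 : forall n (x : D n), d _ (d _ x) = 0;
  dg_succ : leibniz succ;
  dg_prec : leibniz prec
}.

End Graded.

(* Quotient.quot is MathComp's quotient of abelian groups, here extended with
   the scaling. A submodClosed predicate has no zmodClosed instance, hence the
   copy quot_pred. *)
Section QuotientModule.
Variables (K : pzRingType) (V : lmodType K) (S : submodClosed V).

Definition quot_pred : {pred V} := fun x => x \in S.

Lemma quot_pred_zmod_closed : zmod_closed quot_pred.
Proof. exact: GRing.submod_closedB (submodClosedP S). Qed.

HB.instance Definition _ := GRing.isZmodClosed.Build V quot_pred quot_pred_zmod_closed.

Definition quotmod : Type := Quotient.quot quot_pred.
HB.instance Definition _ := GRing.Zmodule.on quotmod.

Definition to_quotmod (x : V) : quotmod := \pi_(Quotient.quot quot_pred) x.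

Lemma to_quotmodE x y : (to_quotmod x = to_quotmod y) <-> (x - y \in S).
Proof.
by split=> [/eqP|xy]; [rewrite -Quotient.idealrBE | apply/eqP; rewrite -Quotient.idealrBE].
Qed.

Lemma to_quotmodD x y : to_quotmod (x + y) = to_quotmod x + to_quotmod y.
Proof. by rewrite /to_quotmod piE. Qed.

Lemma to_quotmodP (u : quotmod) : exists x, u = to_quotmod x.
Proof. by exists (repr (u : Quotient.quot quot_pred)); rewrite /to_quotmod reprK. Qed.

Definition qscale (a : K) (u : quotmod) : quotmod :=
  to_quotmod (a *: repr (u : Quotient.quot quot_pred)).

Lemma to_quotmodZ a x : qscale a (to_quotmod x) = to_quotmod (a *: x).
Proof.
apply/to_quotmodE; rewrite -scalerBr rpredZ //; apply/to_quotmodE.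
by rewrite /to_quotmod reprK.
Qed.

Let qscaleA a b u : qscale a (qscale b u) = qscale (a * b) u.
Proof. by have [x ->] := to_quotmodP u; rewrite !to_quotmodZ scalerA. Qed.

Let qscale1 : left_id 1 qscale.
Proof. by move=> u; have [x ->] := to_quotmodP u; rewrite to_quotmodZ scale1r. Qed.

Let qscaleDr : right_distributive qscale +%R.
Proof.
move=> a u v; have [x ->] := to_quotmodP u; have [y ->] := to_quotmodP v.
by rewrite -to_quotmodD !to_quotmodZ scalerDr to_quotmodD.
Qed.

Let qscaleDl u : {morph qscale^~ u : a b / a + b}.
Proof.
move=> a b /=; have [x ->] := to_quotmodP u.
by rewrite !to_quotmodZ scalerDl to_quotmodD.
Qed.

HB.instance Definition _ :=
  GRing.Zmodule_isLmodule.Build K quotmod qscaleA qscale1 qscaleDr qscaleDl.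

End QuotientModule.

Section Cohomology.
Variables (K : comPzRingType) (C : nat -> lmodType K).
Variable d : forall n, {linear C n -> C n.+1}.

Section Degree.
Variable n : nat.

Definition cocycle : {pred C n} := fun u => d n u == 0.

Lemma cocycle_submod : submod_closed cocycle.
Proof.
by split=> [|a u v]; rewrite !unfold_in ?linear0 // linearP
  => /eqP-> /eqP->; rewrite scaler0 addr0.
Qed.

HB.instance Definition _ :=
  GRing.isSubmodClosed.Build K (C n) cocycle cocycle_submod.

Definition cocycles : Type := {u : C n | cocycle u}.
HB.instance Definition _ := [isSub of cocycles for sval].
HB.instance Definition _ := [Choice of cocycles by <:].
HB.instance Definition _ := [SubChoice_isSubLmodule of cocycles by <:].

End Degree.

Definition is_coboundary n : C n -> Prop :=
  if n is m.+1 then fun u => exists w : C m, u = d m w else fun u => u = 0.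

Definition coboundary n : {pred cocycles n} := fun u => `[< is_coboundary (val u) >].

Lemma coboundary_submod n : submod_closed (@coboundary n).
Proof.
rewrite /coboundary; case: n => [|n]; split=> [|a u v]; rewrite !unfold_in.
- exact/asboolP.
- move=> /asboolP/= u0 /asboolP/= v0; apply/asboolP => /=.
  by rewrite u0 v0 scaler0 addr0.
- by apply/asboolP; exists 0; rewrite (linear0 (d n)).
- move=> /asboolP/= [w uE] /asboolP/= [w' vE]; apply/asboolP; exists (a *: w + w').
  by rewrite uE vE linearP.
Qed.

HB.instance Definition _ n :=
  GRing.isSubmodClosed.Build K (cocycles n) (@coboundary n) (@coboundary_submod n).

Definition cohomology n : lmodType K := quotmod (@coboundary n).

Definition cohclass n (u : C n) (du : d n u = 0) : cohomology n :=
  to_quotmod (@coboundary n) (Sub u (introT eqP du) : cocycles n).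

(* Every class being the class of a cocycle, there is at most one such mH. *)
Definition induces (m : gprod C) (mH : gprod cohomology) : Prop :=
  forall p q (x : C p) (y : C q) (dx : d p x = 0) (dy : d q y = 0),
    exists dxy : d (p + q)%N (m _ _ x y) = 0,
      mH _ _ (cohclass dx) (cohclass dy) = cohclass dxy.

End Cohomology.

Section RackCochains.
Variables (K : comPzRingType) (X : rack) (A : assocAlg K).

Definition CR (n : nat) : lmodType K := (n.-tuple X -> A).

(* i : 'I_n.+1 stands for the 1-based position i.+1; lift i j is j if j < i and
   j.+1 otherwise. *)
Definition rack_d0 n (i : 'I_n.+1) (f : CR n) : CR n.+1 :=
  fun x => f [tuple if (j < i)%N then tnth x (lift i j)
                    else tnth x i ▷ tnth x (lift i j) | j < n].

Definition rack_d1 n (i : 'I_n.+1) (f : CR n) : CR n.+1 :=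
  fun x => f [tuple tnth x (lift i j) | j < n].

Definition rack_d n (f : CR n) : CR n.+1 :=
  \sum_(i < n.+1) (-1) ^+ i.+1 *: (rack_d0 i f - rack_d1 i f).

Lemma rack_d_linear n : linear (@rack_d n).
Proof.
move=> a f g; rewrite /rack_d scaler_sumr -big_split /=; apply: eq_bigr => i _.
have -> : rack_d0 i (a *: f + g) = a *: rack_d0 i f + rack_d0 i g by [].
have -> : rack_d1 i (a *: f + g) = a *: rack_d1 i f + rack_d1 i g by [].
rewrite scalerA [a * _]mulrC -scalerA -scalerDr scalerBr; congr (_ *: _).
by rewrite opprD addrACA.
Qed.

HB.instance Definition _ n :=
  GRing.isLinear.Build K (CR n) (CR n.+1) _ (@rack_d n) (@rack_d_linear n).

Definition rackD n : {linear CR n -> CR n.+1} := @rack_d n.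

Section Shuffles.
Variables p q : nat.

Definition shuffles : {set 'S_(p + q)} :=
  [set s : 'S_(p + q) |
    [forall i : 'I_p, forall j : 'I_p,
       (i < j)%N ==> (s (lshift q i) < s (lshift q j))%N] &&
    [forall i : 'I_q, forall j : 'I_q,
       (i < j)%N ==> (s (rshift p i) < s (rshift p j))%N]].

(* In 1-based terms: s sends k to p + q. *)
Definition sends_to_last (k : nat) (s : 'S_(p + q)) : bool :=
  [forall i : 'I_(p + q), (i.+1 == k) ==> ((s i).+1 == (p + q)%N)].

(* Degree 0 is by convention; sends_to_last 0 would hold vacuously. *)
Definition shuffles_succ : {set 'S_(p + q)} :=
  if p == 0%N then [set 1%g]
  else if q == 0%N then set0
  else [set s in shuffles | sends_to_last (p + q)%N s].

Definition shuffles_prec : {set 'S_(p + q)} :=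
  if p == 0%N then set0
  else if q == 0%N then [set 1%g]
  else [set s in shuffles | sends_to_last p s].

Definition shuffle_y (s : 'S_(p + q)) (x : (p + q).-tuple X) : p.-tuple X :=
  [tuple foldr (fun i y => tnth x i ▷ y) (tnth x (s (lshift q k)))
     [seq i <- enum 'I_(p + q) |
        (i \in [set s (rshift p l) | l : 'I_q]) && (i < s (lshift q k))%N]
   | k < p].

Definition shuffle_z (s : 'S_(p + q)) (x : (p + q).-tuple X) : q.-tuple X :=
  [tuple tnth x (s (rshift p k)) | k < q].

Definition shuffle_prod (S : {set 'S_(p + q)}) (f : CR p) (g : CR q) :
    CR (p + q)%N :=
  fun x => \sum_(s in S) (-1) ^+ s *:
    amul (f (shuffle_y s x)) (g (shuffle_z s x)).

End Shuffles.

Definition rack_succ : gprod CR := fun p q => shuffle_prod (shuffles_succ p q).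
Definition rack_prec : gprod CR := fun p q => shuffle_prod (shuffles_prec p q).

Definition HR : nat -> lmodType K := cohomology rackD.

End RackCochains.

(* Main.v *)
Require Import Defs.
From mathcomp Require Import all_boot all_algebra.
From mathcomp Require Import all_fingroup boolp functions.

(** The proof replaces the sums over shuffles by a recursion on the argument
    list, along which all the identities are proved by induction.

    A cochain of degree p is viewed as a function of lists of any length that
    vanishes off length p ([ext]).  For such a function f and a point x, put
    f_x (xs) = f (x, xs) ([slice]), x.f (xs) = f (x ▷ xs), with x acting on every
    entry ([translate]), and let eps f be f times the sign of its degree.  In a
    shuffle, the first entry x of the argument is given either to the first
    factor, and then no entry acts on it, or to the second one, and then it acts
    on every argument of the first factor and moves past all of them.  So each of
    the two products is determined by
      (f * g)_x = f_x * g + eps (x.f) * g_x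
    and by the factor to which the last entry must go ([hshuf]).  Likewise
      (d f)_x = f - x.f - d (f_x)
    determines the differential ([list_d]).  Self-distributivity of the rack makes
    f |-> x.f compatible with the products and with d ([translate_hshuf],
    [translate_list_d]), and eps is multiplicative and anticommutes with d.

    Substituting the two rules into each side of an identity reduces the identity
    at (x, xs) to instances of itself at xs: this yields the three dendriform
    identities ([hshuf_succ_succ], [hshuf_succ_prec], [hshuf_prec_prec]), the
    square-zero property ([list_d_list_d]) and the Leibniz rule ([list_d_hshuf]).

    The link with permutations is [shuffle_sum_hshuf]: removing the value 0 from a
    permutation s of n + 1 points leaves a permutation of n points, and in a
    (p, q)-shuffle that value sits at position 0 or at position p, which are the
    two terms of the recursion.

    Finally, a bilinear product that satisfies the Leibniz rule descends to
    cohomology, and the dendriform identities descend with the products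
    ([dendriform_cohomology]). *)

Set Implicit Arguments.
Unset Strict Implicit.
Unset Printing Implicit Defensive.
Import GRing.Theory.
Local Open Scope ring_scope.

(** * Half-shuffle products on functions of lists *)

Section ListCochains.
Variables (K : comPzRingType) (X : rack) (A : assocAlg K).
Implicit Types (f g h : seq X -> A) (x : X) (xs : seq X) (t w : bool).

Lemma amulDl (a b c : A) : amul (a + b) c = amul a c + amul b c.
Proof. by have := amul_linearl c 1 a b; rewrite !scale1r. Qed.
Lemma amulDr (a b c : A) : amul c (a + b) = amul c a + amul c b.
Proof. by have := amul_linearr c 1 a b; rewrite !scale1r. Qed.
Lemma amul0l (a : A) : amul 0 a = 0.
Proof. by apply: (addrI (amul 0 a)); rewrite -amulDl !addr0. Qed.
Lemma amul0r (a : A) : amul a 0 = 0.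
Proof. by apply: (addrI (amul a 0)); rewrite -amulDr !addr0. Qed.
Lemma amulZl k (a b : A) : amul (k *: a) b = k *: amul a b.
Proof. by have := amul_linearl b k a 0; rewrite amul0l !addr0. Qed.
Lemma amulZr k (a b : A) : amul a (k *: b) = k *: amul a b.
Proof. by have := amul_linearr a k b 0; rewrite amul0r !addr0. Qed.

(** The function f with its first argument set to x. *)
Definition slice x f : seq X -> A := fun xs => f (x :: xs).
(** The function f with x acting on each of its arguments. *)
Definition translate x f : seq X -> A := fun xs => f (map (rop x) xs).
(** The function f multiplied by (-1)^p on the lists of length p. *)
Definition eps f : seq X -> A := fun xs => (-1) ^+ size xs *: f xs.

(** The two half-shuffle products.  The boolean t tells which factor must receive
    the last entry: the first one if t = true (the product ≺), the second one if
    t = false (the product ≻).  The boolean w decides the value at the empty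
    list.  In the recursive calls it records whether the entry just read went to
    the prescribed factor; at the start it encodes the convention in degree 0, so
    that ≻ is [hshuf false true] and ≺ is [hshuf true false].  On nonempty lists
    the value does not depend on w.  The operator eps accounts for the entry x
    moving past all the arguments of f. *)
Fixpoint hshuf t w f g xs {struct xs} : A :=
  if xs is x :: xs' then
    hshuf t t (slice x f) g xs' +
    hshuf t (~~ t) (eps (translate x f)) (slice x g) xs'
  else if w then amul (f [::]) (g [::]) else 0.

(** The rack differential, in all degrees at once: the index i = 1 contributes
    f xs' - f (x ▷ xs'), the larger ones form the differential of f_x with the
    opposite sign. *)
Fixpoint list_d f xs {struct xs} : A :=
  if xs is x :: xs' then f xs' - translate x f xs' - list_d (slice x f) xs'
  else 0.

Lemma epsD f g : eps (f + g) = eps f + eps g.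
Proof. by apply/funext => xs; rewrite /eps !fctE scalerDr. Qed.
Lemma epsZ k f : eps (k *: f) = k *: eps f.
Proof. by apply/funext => xs; rewrite /eps !fctE !scalerA mulrC. Qed.
Lemma epsK f : eps (eps f) = f.
Proof.
by apply/funext => xs; rewrite /eps scalerA -exprMn mulrNN mulr1 expr1n scale1r.
Qed.
Lemma slice_eps x f : slice x (eps f) = - eps (slice x f).
Proof. by apply/funext => xs; rewrite /slice /eps /= exprS mulN1r scaleNr. Qed.
Lemma translate_eps x f : translate x (eps f) = eps (translate x f).
Proof. by apply/funext => xs; rewrite /translate /eps size_map. Qed.
Lemma sliceD x f g : slice x (f + g) = slice x f + slice x g. Proof. by []. Qed.
Lemma translateD x f g : translate x (f + g) = translate x f + translate x g.
Proof. by []. Qed.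

(** This is the only use of self-distributivity. *)
Lemma translate_translate x y f :
  translate x (translate (x ▷ y) f) = translate y (translate x f).
Proof.
apply/funext => xs; rewrite /translate -!map_comp; congr f; apply: eq_map => z /=.
by rewrite -rop_selfdistr.
Qed.

Lemma hshuf_linearl t w g : linear (fun f => hshuf t w f g).
Proof.
move=> k f f' /=; apply/funext => xs.
elim: xs t w k f f' g => [|x xs IH] t w k f f' g.
  by rewrite !fctE /=; case: w; rewrite ?amulDl ?amulZl // scaler0 addr0.
transitivity (hshuf t t (k *: slice x f + slice x f') g xs +
  hshuf t (~~ t) (eps (k *: translate x f + translate x f')) (slice x g) xs) => //.
by rewrite epsD epsZ !IH !fctE /= scalerDr addrACA.
Qed.

Lemma hshuf_linearr t w f : linear (hshuf t w f).
Proof.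
move=> k g g'; apply/funext => xs.
elim: xs t w k f g g' => [|x xs IH] t w k f g g'.
  by rewrite !fctE /=; case: w; rewrite ?amulDr ?amulZr // scaler0 addr0.
transitivity (hshuf t t (slice x f) (k *: g + g') xs +
  hshuf t (~~ t) (eps (translate x f)) (k *: slice x g + slice x g') xs) => //.
by rewrite !IH !fctE /= scalerDr addrACA.
Qed.

Lemma hshufDl t w f f' g : hshuf t w (f + f') g = hshuf t w f g + hshuf t w f' g.
Proof. by have := hshuf_linearl t w g 1 f f'; rewrite !scale1r. Qed.
Lemma hshufDr t w f g g' : hshuf t w f (g + g') = hshuf t w f g + hshuf t w f g'.
Proof. by have := hshuf_linearr t w f 1 g g'; rewrite !scale1r. Qed.
Lemma hshuf0l t w g : hshuf t w 0 g = 0.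
Proof. by apply: (addrI (hshuf t w 0 g)); rewrite -hshufDl !addr0. Qed.
Lemma hshuf0r t w f : hshuf t w f 0 = 0.
Proof. by apply: (addrI (hshuf t w f 0)); rewrite -hshufDr !addr0. Qed.
Lemma hshufZl k t w f g : hshuf t w (k *: f) g = k *: hshuf t w f g.
Proof. by have := hshuf_linearl t w g k f 0; rewrite hshuf0l !addr0. Qed.
Lemma hshufZr k t w f g : hshuf t w f (k *: g) = k *: hshuf t w f g.
Proof. by have := hshuf_linearr t w f k g 0; rewrite hshuf0r !addr0. Qed.
Lemma hshufNl t w f g : hshuf t w (- f) g = - hshuf t w f g.
Proof. by rewrite -!scaleN1r hshufZl. Qed.
Lemma hshufNr t w f g : hshuf t w f (- g) = - hshuf t w f g.
Proof. by rewrite -!scaleN1r hshufZr. Qed.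

Lemma slice_hshuf x t w f g :
  slice x (hshuf t w f g) =
    hshuf t t (slice x f) g + hshuf t (~~ t) (eps (translate x f)) (slice x g).
Proof. by []. Qed.

Lemma translate_hshuf x t w f g :
  translate x (hshuf t w f g) = hshuf t w (translate x f) (translate x g).
Proof.
apply/funext => xs; elim: xs t w f g => [|y xs IH] t w f g //.
transitivity (translate x (hshuf t t (slice (x ▷ y) f) g) xs +
  translate x (hshuf t (~~ t) (eps (translate (x ▷ y) f))
                     (slice (x ▷ y) g)) xs) => //.
by rewrite !IH translate_eps translate_translate.
Qed.

Lemma eps_hshuf t w f g : eps (hshuf t w f g) = hshuf t w (eps f) (eps g).
Proof.
apply/funext => xs; elim: xs t w f g => [|y xs IH] t w f g.
  by rewrite /eps /= !scale1r.
transitivity (- (eps (hshuf t t (slice y f) g) xs +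
  eps (hshuf t (~~ t) (eps (translate y f)) (slice y g)) xs)).
  by rewrite /eps /= exprS mulN1r scaleNr scalerDr.
by rewrite !IH /= !slice_eps translate_eps hshufNl hshufNr !fctE opprD.
Qed.

(** The three dendriform identities.  Arbitrary values at the empty list are
    needed for the induction; the relation between the booleans on the two sides
    makes both sides agree there.  In the first and the last identity, the sum of the two
    half-products with opposite values at the empty list is the full shuffle
    product, whichever of the two carries the value. *)
Lemma hshuf_succ_succ w w' v f g h :
  hshuf false w f (hshuf false w' g h) =
    hshuf false (w && w') (hshuf false v f g + hshuf true (~~ v) f g) h.
Proof.
apply/funext => xs; elim: xs w w' v f g h => [|x xs IH] w w' v f g h.
  by rewrite /= !fctE /=; case: w; case: w'; case: v;
    rewrite //= ?amul0r // ?addr0 ?add0r amulA.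
rewrite /= !slice_hshuf !translateD !sliceD !slice_hshuf !translate_hshuf.
rewrite !epsD !eps_hshuf.
rewrite hshufDr !fctE (IH _ _ false) (IH _ _ true) (IH _ _ v) /=.
by rewrite !hshufDl !fctE !addrA; congr (_ + _ + _); rewrite (ACl (1*3*2*4)).
Qed.

Lemma hshuf_succ_prec c v b w f g h : c && v = b && w ->
  hshuf true c (hshuf false v f g) h = hshuf false b f (hshuf true w g h).
Proof.
move=> cvbw; apply/funext => xs.
elim: xs c v b w cvbw f g h => [|x xs IH] c v b w cvbw f g h.
  by move: cvbw; rewrite /=; case: c; case: v; case: b; case: w;
    rewrite //= ?amul0r ?amul0l // amulA.
rewrite /= !slice_hshuf !translate_hshuf !eps_hshuf hshufDl hshufDr !fctE.
by rewrite (IH _ _ false w) // (IH _ _ true true) // (IH _ _ true false) ?addrA.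
Qed.

Lemma hshuf_prec_prec c v w f g h :
  hshuf true c (hshuf true v f g) h =
    hshuf true (c && v) f (hshuf false w g h + hshuf true (~~ w) g h).
Proof.
apply/funext => xs; elim: xs c v w f g h => [|x xs IH] c v w f g h.
  by rewrite /= !fctE /=; case: c; case: v; case: w;
    rewrite //= ?amul0l // ?addr0 ?add0r amulA.
rewrite /= !slice_hshuf !sliceD !slice_hshuf !translate_hshuf !eps_hshuf.
rewrite hshufDl !fctE.
rewrite (IH _ _ w) (IH _ _ false) (IH _ _ true) /=.
by rewrite !hshufDr !fctE -[LHS]addrA; congr (_ + _); rewrite addrACA.
Qed.

Lemma list_d_linear : linear list_d.
Proof.
move=> k f f'; apply/funext => xs.
elim: xs k f f' => [|x xs IH] k f f'; first by rewrite !fctE /= scaler0 addr0.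
transitivity ((k *: f + f') xs - (k *: translate x f + translate x f') xs -
  list_d (k *: slice x f + slice x f') xs) => //.
rewrite IH !fctE /= !scalerBr !opprD [RHS]addrACA; congr (_ + _).
by rewrite addrACA.
Qed.

Lemma list_dD f g : list_d (f + g) = list_d f + list_d g.
Proof. by have := list_d_linear 1 f g; rewrite !scale1r. Qed.
Lemma list_d0 : list_d 0 = 0.
Proof. by apply: (addrI (list_d 0)); rewrite -list_dD !addr0. Qed.
Lemma list_dZ k f : list_d (k *: f) = k *: list_d f.
Proof. by have := list_d_linear k f 0; rewrite list_d0 !addr0. Qed.
Lemma list_dN f : list_d (- f) = - list_d f.
Proof. by rewrite -scaleN1r list_dZ scaleN1r. Qed.

Lemma slice_list_d x f :
  slice x (list_d f) = f - translate x f - list_d (slice x f).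
Proof. by []. Qed.

Lemma translate_list_d x f : translate x (list_d f) = list_d (translate x f).
Proof.
apply/funext => xs; elim: xs f => [|y xs IH] f //.
transitivity (translate x f xs - translate x (translate (x ▷ y) f) xs -
  translate x (list_d (slice (x ▷ y) f)) xs) => //.
by rewrite translate_translate IH.
Qed.

Lemma eps_list_d f : eps (list_d f) = - list_d (eps f).
Proof.
apply/funext => xs; elim: xs f => [|y xs IH] f.
  by rewrite /eps /= !fctE /= scaler0 oppr0.
transitivity (- (eps f xs - eps (translate y f) xs - eps (list_d (slice y f)) xs)).
  by rewrite /eps /= exprS mulN1r scaleNr -!scalerBr.
by rewrite IH !fctE /= translate_eps slice_eps list_dN.
Qed.

Lemma list_d_list_d f : list_d (list_d f) = 0.
Proof.
apply/funext => xs; elim: xs f => [|x xs IH] f //.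
rewrite /= slice_list_d translate_list_d !list_dD !list_dN !fctE IH.
by have ->: (0 : seq X -> A) xs = 0 by []; rewrite subr0 subrr.
Qed.

(** The Leibniz rule.  The values w' and w'' at the empty list are free because
    list_d f and list_d g vanish there. *)
Lemma list_d_hshuf t w w' w'' f g :
  list_d (hshuf t w f g) =
    hshuf t w' (list_d f) g + hshuf t w'' (eps f) (list_d g).
Proof.
apply/funext => xs; elim: xs w w' w'' f g => [|x xs IH] w w' w'' f g.
  by rewrite !fctE /=; case: w'; case: w''; rewrite ?amul0r ?amul0l ?addr0.
rewrite !fctE /= !slice_hshuf !slice_list_d !slice_eps !translate_hshuf.
rewrite !translate_list_d !translate_eps !epsK.
rewrite !eps_list_d !list_dD !fctE (IH _ t t) (IH _ (~~ t) (~~ t)) epsK.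
rewrite !hshufDl !hshufDr !hshufNl !hshufNr !fctE !opprD !addrA.
(* What remains is f * g - x.f * x.g on the left, and on the right
   (f * g - x.f * g) + (x.f * g - x.f * x.g), up to the values of the products at
   the empty list; there each difference is zero since x.f and f agree. *)
rewrite [RHS](ACl (1*2*6*7*3*5*4*8)) /=; do 4!congr (_ + _).
case: xs {IH} => [|y xs] /=; last by rewrite subrK.
by case: w; case: t; rewrite /translate /= !subrr ?subr0 ?add0r ?subrr.
Qed.

End ListCochains.

(** * Shuffles as words *)

Section ShuffleWords.

(** The list of values of a permutation. *)
Definition word n (s : 'S_n) : seq nat := [seq val (s i) | i <- enum 'I_n].

Lemma size_word n (s : 'S_n) : size (word s) = n.
Proof. by rewrite size_map size_enum_ord. Qed.

Lemma nth_word n (s : 'S_n) (i : 'I_n) : nth 0%N (word s) i = s i.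
Proof. by rewrite (nth_map i) ?size_enum_ord // nth_ord_enum. Qed.

(** [lift_perm i ord0 t] is the permutation that takes the value 0 at i and whose
    other values are those of t, in the same order, increased by one. *)
Lemma word_lift n (i : 'I_n.+1) (t : 'S_n) :
  word (lift_perm i ord0 t) =
    take i (map S (word t)) ++ 0%N :: drop i (map S (word t)).
Proof.
have ilen : (i <= size (map S (word t)))%N by rewrite size_map size_word -ltnS.
apply: (@eq_from_nth _ 0%N) => [|k].
  by rewrite size_cat /= addnS -size_cat cat_take_drop size_map !size_word.
rewrite size_word => kn; rewrite -[k]/(val (Ordinal kn)) nth_word.
move: (Ordinal kn) => {kn}k.
rewrite nth_cat size_takel //.
case: (unliftP i k) => [j ->|->]; last first.
  by rewrite lift_perm_id ltnn subnn.
rewrite lift_perm_lift /= /bump leq0n add1n.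
case: (leqP i j) => [ij|ji].
  rewrite add1n ltnNge (leq_trans ij) //= subSn //= nth_drop subnKC //.
  by rewrite (nth_map 0%N) ?size_word // nth_word.
by rewrite add0n ji nth_take // (nth_map 0%N) ?size_word ?nth_word //
  (leq_trans ji) // -ltnS.
Qed.

Lemma lift_perm_bij n :
  bijective (fun it : 'I_n.+1 * 'S_n => lift_perm it.1 ord0 it.2).
Proof.
apply: inj_card_bij => [[i t] [j u] /= e|]; last first.
  by rewrite card_prod !card_Sn card_ord.
have ij : i = j.
  apply: (@perm_inj _ (lift_perm i ord0 t)).
  by rewrite lift_perm_id e lift_perm_id.
rewrite -ij in e *; congr (_, _); apply/permP => k; apply: (@lift_inj _ ord0).
by rewrite -(lift_perm_lift i) e lift_perm_lift.
Qed.

Lemma sorted_cat0 (l r : seq nat) : sorted ltn (l ++ 0%N :: r) -> l = [::].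
Proof.
case: l => [//|a l]; rewrite /= (path_sortedE ltn_trans) => /andP[/allP al _].
by have := al 0%N; rewrite mem_cat in_cons eqxx orbT => /(_ isT).
Qed.

Lemma sorted_mapS (l : seq nat) : sorted ltn (map S l) = sorted ltn l.
Proof. by rewrite sorted_map; apply: eq_sorted. Qed.

Lemma sorted_0mapS (l : seq nat) : sorted ltn (0%N :: map S l) = sorted ltn l.
Proof.
rewrite /= (path_sortedE ltn_trans) sorted_mapS andb_idl // => _.
by apply/allP => _ /mapP[k _ ->].
Qed.

(** For the word l ++ r of a permutation of n points, the condition that both l and
    r increase and that the largest value n - 1 occurs in l if t = true, and in r
    if t = false.  For n = 0 there is no largest value and w decides, as in
    [hshuf]. *)
Definition hshuf_word t w n (l r : seq nat) : bool :=
  [&& sorted ltn l, sorted ltn r &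
      if n is n'.+1 then n' \in (if t then l else r) else w].

Lemma hshuf_word_consl t w n l r :
  hshuf_word t w n.+1 (0%N :: map S l) (map S r) = hshuf_word t t n l r.
Proof.
rewrite /hshuf_word sorted_0mapS sorted_mapS; do 2!congr (_ && _).
case: t; case: n => [|n] //=; rewrite ?in_cons ?mem_map //=; try exact: succn_inj.
by apply/mapP => -[].
Qed.

Lemma hshuf_word_consr t w n l r :
  hshuf_word t w n.+1 (map S l) (0%N :: map S r) = hshuf_word t (~~ t) n l r.
Proof.
rewrite /hshuf_word sorted_0mapS sorted_mapS; do 2!congr (_ && _).
case: t; case: n => [|n] //=; rewrite ?in_cons ?mem_map //=; try exact: succn_inj.
by apply/mapP => -[].
Qed.

Lemma take_word p q (s : 'S_(p + q)) :
  take p (word s) = [seq val (s (lshift q i)) | i <- enum 'I_p].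
Proof.
have sz : size (take p (word s)) = p by rewrite size_takel // size_word leq_addr.
apply: (@eq_from_nth _ 0%N) => [|i]; rewrite sz 1?size_map 1?size_enum_ord // => ip.
rewrite nth_take // (nth_map (Ordinal ip)) ?size_enum_ord //.
rewrite -[i in LHS]/(val (lshift q (Ordinal ip))) nth_word.
by congr (val (s (lshift q _))); apply: val_inj; rewrite /= nth_enum_ord.
Qed.

Lemma drop_word p q (s : 'S_(p + q)) :
  drop p (word s) = [seq val (s (rshift p i)) | i <- enum 'I_q].
Proof.
have sz : size (drop p (word s)) = q by rewrite size_drop size_word addKn.
apply: (@eq_from_nth _ 0%N) => [|i]; rewrite sz 1?size_map 1?size_enum_ord // => iq.
rewrite nth_drop // (nth_map (Ordinal iq)) ?size_enum_ord //.
rewrite -[(p + i)%N in LHS]/(val (rshift p (Ordinal iq))) nth_word.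
by congr (val (s (rshift p _))); apply: val_inj; rewrite /= nth_enum_ord.
Qed.

Lemma sorted_map_enum n (F : 'I_n -> nat) :
  sorted ltn [seq F i | i <- enum 'I_n] =
  [forall i : 'I_n, forall j : 'I_n, (i < j)%N ==> (F i < F j)%N].
Proof.
rewrite (sorted_pairwise ltn_trans) pairwise_map.
case: n F => [|n] F.
  have -> : enum 'I_0 = [::] by apply/size0nil; rewrite size_enum_ord.
  by symmetry; apply/forallP => -[].
apply/(pairwiseP ord0)/forallP => [H i|H i j]; rewrite ?inE ?size_enum_ord.
  apply/forallP => j; apply/implyP => ij.
  have := H i j; rewrite !inE size_enum_ord !ltn_ord !nth_ord_enum.
  exact.
move=> ilt jlt ij; have /forallP/(_ (Ordinal jlt))/implyP := H (Ordinal ilt).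
have nthE k (kn : (k < n.+1)%N) : nth ord0 (enum 'I_n.+1) k = Ordinal kn.
  exact: (nth_ord_enum ord0 (Ordinal kn)).
by rewrite /= (nthE i) (nthE j) => /(_ ij).
Qed.

Lemma mem_shuffles p q (s : 'S_(p + q)) :
  (s \in shuffles p q) =
  sorted ltn (take p (word s)) && sorted ltn (drop p (word s)).
Proof. by rewrite inE take_word drop_word !sorted_map_enum. Qed.

Lemma word_inj n : injective (@word n).
Proof.
move=> s u e; apply/permP => i; apply: val_inj.
by rewrite /= -!nth_word e.
Qed.

Lemma word1 n : word (1%g : 'S_n) = iota 0 n.
Proof. by rewrite -val_enum_ord; apply: eq_map => i; rewrite perm1. Qed.

Lemma mem_word n (s : 'S_n) k : (k \in word s) = (k < n)%N.
Proof.
apply/mapP/idP => [[i _ ->]|kn]; first exact: ltn_ord.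
by exists ((s^-1)%g (Ordinal kn)); rewrite ?mem_enum ?permKV.
Qed.

Lemma sorted_word n (s : 'S_n) : sorted ltn (word s) = (s == 1%g).
Proof.
apply/idP/eqP => [ss|->]; last by rewrite word1 iota_ltn_sorted.
apply/word_inj/(irr_sorted_eq ltn_trans ltnn) => // [|k].
  by rewrite word1 iota_ltn_sorted.
by rewrite !mem_word.
Qed.

(** The largest value of an increasing list can only be its last entry. *)
Lemma sorted_mem_max (l : seq nat) m :
  sorted ltn l -> {in l, forall k, k <= m}%N -> (0 < size l)%N ->
  (m \in l) = (nth 0%N l (size l).-1 == m).
Proof.
move=> sl lm sz; have lt : ((size l).-1 < size l)%N by rewrite prednK.
apply/idP/eqP => [|<-]; last exact: mem_nth.
case/(nthP 0%N) => i il im; apply/eqP; rewrite eqn_leq lm ?mem_nth //=.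
rewrite -{1}im; have : (i <= (size l).-1)%N by rewrite -ltnS prednK.
rewrite leq_eqVlt => /orP[/eqP->//|ilt].
by rewrite ltnW //; apply: (sorted_ltn_nth ltn_trans).
Qed.

Lemma sends_to_lastE p q (s : 'S_(p + q)) k : (0 < k <= p + q)%N ->
  sends_to_last k s = (nth 0%N (word s) k.-1 == (p + q).-1).
Proof.
case/andP=> k0 kn; have kn' : (k.-1 < p + q)%N by rewrite prednK.
have n0 : (0 < p + q)%N by apply: leq_trans kn.
have nE : nth 0%N (word s) k.-1 = s (Ordinal kn').
  by rewrite -nth_word.
apply/forallP/eqP => [/(_ (Ordinal kn'))|e i].
  rewrite /= prednK // eqxx nE /= => /eqP e.
  by apply: succn_inj; rewrite e prednK.
apply/implyP => /eqP ik; apply/eqP; rewrite -[RHS]prednK // -e -ik.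
by rewrite -(nth_word s i).
Qed.

Lemma mem_shuffles_succ p q (s : 'S_(p + q)) :
  (s \in shuffles_succ p q) =
  hshuf_word false true (p + q) (take p (word s)) (drop p (word s)).
Proof.
rewrite /shuffles_succ /hshuf_word; case: p s => [|p] s /=.
  rewrite inE take0 drop0 -sorted_word; case: q s => [|q] s /=.
    by rewrite andbT.
  by rewrite mem_word ltnS leqnn andbT.
case: q s => [|q] s.
  by rewrite inE drop_oversize ?andbF // size_word addn0.
rewrite inE mem_shuffles -andbA /=; congr andb; apply: andb_id2l => sd.
rewrite sends_to_lastE ?leqnn // sorted_mem_max //.
- rewrite size_drop size_word addKn nth_drop.
  by congr (nth _ _ _ == _); rewrite /= addnS.
- by move=> k /mem_drop; rewrite mem_word ltnS.
- by rewrite size_drop size_word addKn.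
Qed.

Lemma mem_shuffles_prec p q (s : 'S_(p + q)) :
  (s \in shuffles_prec p q) =
  hshuf_word true false (p + q) (take p (word s)) (drop p (word s)).
Proof.
rewrite /shuffles_prec /hshuf_word; case: p s => [|p] s /=.
  by rewrite inE take0; case: q s => [|q] s; rewrite ?andbF.
case: q s => [|q] s.
  rewrite inE take_oversize ?drop_oversize ?size_word ?addn0 //=.
  have ltp : (p + 0 < p.+1 + 0)%N by [].
  by rewrite mem_word -sorted_word ltp andbT.
rewrite inE mem_shuffles -andbA /=; apply: andb_id2l => st; congr andb.
have szt : size (take p.+1 (word s)) = p.+1.
  by rewrite size_takel // size_word leq_addr.
rewrite sends_to_lastE ?leq_addr // sorted_mem_max ?szt //.
- by rewrite nth_take.
- by move=> k /mem_take; rewrite mem_word ltnS.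
Qed.

End ShuffleWords.

(** * Sums over shuffles satisfy the recursion *)

Section Bridge.
Variables (K : comPzRingType) (X : rack) (A : assocAlg K).
Implicit Types (f g h : seq X -> A) (x : X) (xs : seq X) (t w : bool).

(** The arguments of the two factors for the shuffle with word l ++ r: the entries
    of xs at the positions in r ([zpart]), and those at the positions k in l, acted
    on by the entries at the positions in r smaller than k ([ypart]).  The default
    x0 is never reached for positions smaller than the length of xs. *)
Definition ypart x0 xs (l r : seq nat) : seq X :=
  [seq foldr (fun i y => nth x0 xs i ▷ y) (nth x0 xs k)
     [seq i <- iota 0 (size xs) | (i \in r) && (i < k)%N] | k <- l].
Definition zpart x0 xs (r : seq nat) : seq X := [seq nth x0 xs k | k <- r].

Lemma iota0S n : iota 0 n.+1 = 0%N :: map S (iota 0 n).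
Proof. by rewrite -(iotaDl 1). Qed.

Lemma zpart_S x0 x xs r : zpart x0 (x :: xs) (map S r) = zpart x0 xs r.
Proof. by rewrite /zpart -map_comp. Qed.

Lemma ypart_consl x0 x xs l r :
  ypart x0 (x :: xs) (0%N :: map S l) (map S r) = x :: ypart x0 xs l r.
Proof.
rewrite /ypart [size _]/= iota0S /=; congr (_ :: _).
  rewrite andbF (_ : filter _ _ = [::]) //; apply/eqP.
  by rewrite -(negbK (_ == _)) -has_filter; apply/hasPn => k _; rewrite andbF.
rewrite -map_comp; apply: eq_map => k /=.
rewrite (_ : (0%N \in _) = false) /=; last by apply/mapP => -[].
rewrite filter_map foldr_map; congr (foldr _ _ _); apply: eq_filter => i /=.
by rewrite ltnS mem_map //; exact: succn_inj.
Qed.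

Lemma ypart_consr x0 x xs l r :
  ypart x0 (x :: xs) (map S l) (0%N :: map S r) = map (rop x) (ypart x0 xs l r).
Proof.
rewrite /ypart [size _]/= iota0S -!map_comp; apply: eq_map => k /=.
rewrite filter_map foldr_map; congr (_ ▷ foldr _ _ _).
by apply: eq_filter => i /=; rewrite ltnS in_cons mem_map //; exact: succn_inj.
Qed.

Lemma size_ypart x0 xs l r : size (ypart x0 xs l r) = size l.
Proof. exact: size_map. Qed.

(** The sum over shuffles that defines the product determined by t and w, with the
    permutations described by their words. *)
Definition shuffle_sum t w p x0 f g xs : A :=
  \sum_(s : 'S_(size xs) |
      hshuf_word t w (size xs) (take p (word s)) (drop p (word s)))
    (-1) ^+ s *: amul (f (ypart x0 xs (take p (word s)) (drop p (word s))))
                      (g (zpart x0 xs (drop p (word s)))).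

(** The functions of lists that are cochains of degree p. *)
Definition supported (p : nat) f := forall xs, size xs != p -> f xs = 0.

Lemma supported_slice p f x : supported p.+1 f -> supported p (slice x f).
Proof. by move=> fp xs sxs; apply: fp. Qed.
Lemma supported0_slice f x : supported 0 f -> slice x f = 0.
Proof. by move=> fp; apply/funext => xs; apply: fp. Qed.
Lemma supported_eps_translate p f x :
  supported p f -> supported p (eps (translate x f)).
Proof. by move=> fp xs sxs; rewrite /eps /translate fp ?scaler0 ?size_map. Qed.
Lemma supported_list_d p f : supported p f -> supported p.+1 (list_d f).
Proof.
elim: p f => [|p IH] f fp [|x xs] //=; rewrite eqSS => sxs.
- by rewrite (supported0_slice x fp) list_d0 /translate !fp ?size_map // !subr0.
- rewrite IH //; last exact: supported_slice.
  by rewrite /translate !fp ?size_map // !subr0.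
Qed.

Lemma supported_hshuf t w p q f g :
  supported p f -> supported q g -> supported (p + q) (hshuf t w f g).
Proof.
move=> fp gq xs; elim: xs t w p q f g fp gq => [|x xs IH] t w p q f g fp gq /=.
  case: p fp => [|p] fp; case: q gq => [|q] gq // _.
  - by rewrite gq // amul0r; case: w.
  - by rewrite fp // amul0l; case: w.
  - by rewrite fp // amul0l; case: w.
move=> sxs.
have -> : hshuf t t (slice x f) g xs = 0.
  case: p fp sxs => [|p] fp sxs.
    by rewrite (supported0_slice x fp) hshuf0l.
  by apply: (IH _ _ p q) => //; exact: supported_slice.
rewrite add0r; case: q gq sxs => [|q] gq sxs.
  by rewrite (supported0_slice x gq) hshuf0r.
apply: (IH _ _ p q); rewrite ?addnS // in sxs *.
  exact: supported_eps_translate.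
exact: supported_slice.
Qed.

(** The sum over shuffles satisfies the recursion that defines [hshuf]. *)
Lemma shuffle_sum_hshuf t w p q x0 f g xs :
  supported p f -> supported q g -> size xs = (p + q)%N ->
  shuffle_sum t w p x0 f g xs = hshuf t w f g xs.
Proof.
elim: xs t w p q f g => [|x xs IH] t w p q f g fp gq.
  case: p fp => // fp; case: q gq => // gq _; rewrite /shuffle_sum [size _]/=.
  have S0 (s : 'S_0) : s = 1%g by apply/permP => -[].
  rewrite big_mkcond /= (big_pred1 1%g) => [|s]; last by rewrite /= (S0 s) eqxx.
  rewrite odd_perm1 scale1r /word /=.
  have -> : enum 'I_0 = [::] by apply/size0nil; rewrite size_enum_ord.
  by rewrite /hshuf_word.
rewrite /shuffle_sum [size _]/= => sxs.
set G := fun l r : seq nat =>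
  amul (f (ypart x0 (x :: xs) l r)) (g (zpart x0 (x :: xs) r)).
(* Sort the permutations by the position i of the value 0. *)
rewrite (reindex _ (onW_bij _ (lift_perm_bij _))) /=.
pose W (i : 'I_(size xs).+1) (t : 'S_(size xs)) := word (lift_perm i ord0 t).
rewrite -(pair_big_dep xpredT
  (fun i u => hshuf_word t w (size xs).+1 (take p (W i u)) (drop p (W i u)))
  (fun i u => (-1) ^+ (lift_perm i ord0 u) *:
     G (take p (W i u)) (drop p (W i u)))) /=.
(* An increasing block can only contain 0 as its first entry. *)
have other (i : 'I_(size xs).+1) u : i != 0%N :> nat -> i != p :> nat ->
    hshuf_word t w (size xs).+1 (take p (W i u)) (drop p (W i u)) = false.
  move=> i0 ip; have ilen : (i <= size (map S (word u)))%N.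
    by rewrite size_map size_word -ltnS.
  apply/negP => /and3P[].
  rewrite /W word_lift take_cat drop_cat size_takel //.
  case: ltngtP ip => // [pi|ip] _.
    move=> _ /sorted_cat0/(congr1 size); rewrite size_drop size_takel //= => /eqP.
    by rewrite subn_eq0 leqNgt pi.
  rewrite -subn_gt0 in ip; case: (p - i)%N ip => //= k _ /sorted_cat0/(congr1 size).
  by rewrite size_takel //=; move/eqP; rewrite (negPf i0).
(* For i = p the first entry goes to g, for i = 0 < p it goes to f. *)
have Gterm (i : 'I_(size xs).+1) : i = p :> nat ->
    \sum_(u | hshuf_word t w (size xs).+1 (take p (W i u)) (drop p (W i u)))
      (-1) ^+ (lift_perm i ord0 u) *: G (take p (W i u)) (drop p (W i u)) =
    hshuf t (~~ t) (eps (translate x f)) (slice x g) xs.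
  move=> ip; have ple : (p <= size xs)%N by rewrite -ip -ltnS.
  case: q gq sxs => [|q] gq sxs.
    by exfalso; move: ple; rewrite -ltnS sxs addn0 ltnn.
  rewrite -(IH _ _ p q); first 1 last.
  - exact: supported_eps_translate.
  - exact: supported_slice.
  - by apply: succn_inj; rewrite sxs addnS.
  have WE u : take p (W i u) = map S (take p (word u)) /\
              drop p (W i u) = 0%N :: map S (drop p (word u)).
    have szp : size (take p (map S (word u))) = p.
      by rewrite size_takel // size_map size_word.
    rewrite map_take map_drop /W word_lift ip.
    by rewrite take_size_cat // drop_size_cat.
  apply: eq_big => [u|u _] /=; have [-> ->] := WE u.
    by rewrite hshuf_word_consr.
  rewrite /G ypart_consr /= zpart_S.
  rewrite /eps /translate amulZl scalerA size_ypart size_takel ?size_word //.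
  by rewrite odd_lift_perm /= signr_addb ip addbF signr_odd mulrC.
have Fterm p' : p = p'.+1 ->
    \sum_(u | hshuf_word t w (size xs).+1 (take p (W ord0 u))
                         (drop p (W ord0 u)))
      (-1) ^+ (lift_perm ord0 ord0 u) *:
        G (take p (W ord0 u)) (drop p (W ord0 u)) =
    hshuf t t (slice x f) g xs.
  move=> pE; rewrite {}pE in fp sxs *.
  rewrite -(IH _ _ p' q) //; last 2 first.
  - exact: supported_slice.
  - by apply: succn_inj; rewrite sxs.
  by apply: eq_big => [u|u _];
    rewrite /W word_lift take0 drop0 /= -map_take -map_drop
    ?hshuf_word_consl // /G ypart_consl zpart_S odd_lift_perm.
case: (posnP p) => [p0|p_gt0].
  rewrite (bigD1 ord0) //= Gterm // big1 ?addr0 => [|i i0]; last first.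
    by rewrite big_pred0 // => u; apply: other; rewrite // p0.
  rewrite p0 in fp.
  by rewrite (supported0_slice x fp) hshuf0l add0r.
have [p' pE] : exists p', p = p'.+1 by exists p.-1; rewrite prednK.
rewrite (bigD1 ord0) //= (Fterm p') //; congr (_ + _).
case: q gq sxs IH => [|q] gq sxs IH.
  rewrite (supported0_slice x gq) hshuf0r big1 // => i i0.
  by rewrite big_pred0 // => u; apply: other => //; rewrite -[p]addn0 -sxs ltn_eqF.
have plt : (p < (size xs).+1)%N by rewrite sxs addnS ltnS leq_addr.
rewrite (bigD1 (Ordinal plt)) /=; last by rewrite -val_eqE /= -lt0n.
rewrite Gterm // big1 ?addr0 // => i /andP[i0 ip].
by rewrite big_pred0 // => u; apply: other.
Qed.

End Bridge.

(** * Rack cochains as functions of lists *)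

Section Ext.
Variables (K : comPzRingType) (X : rack) (A : assocAlg K).

(** The extension of a cochain of degree n by zero to lists of any length. *)
Definition ext n (f : CR X A n) : seq X -> A :=
  fun xs => oapp f 0 (insub xs : option (n.-tuple X)).

Lemma ext_tuple n (f : CR X A n) (x : n.-tuple X) : ext f x = f x.
Proof. by rewrite /ext valK. Qed.

Lemma extE n (f : CR X A n) (x : n.-tuple X) xs : tval x = xs -> f x = ext f xs.
Proof. by move=> <-; rewrite ext_tuple. Qed.

Lemma supported_ext n (f : CR X A n) : supported n (ext f).
Proof. by move=> xs sxs; rewrite /ext insubN. Qed.

Lemma ext_inj n : injective (@ext n).
Proof. by move=> f g fg; apply/funext => x; rewrite -!ext_tuple fg. Qed.

Lemma supported_eq n (f g : seq X -> A) : supported n f -> supported n g ->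
  (forall x : n.-tuple X, f x = g x) -> f = g.
Proof.
move=> fn gn fg; apply/funext => xs; case: (eqVneq (size xs) n) => [sn|sn].
  exact: (fg (Tuple (introT eqP sn))).
by rewrite fn ?gn.
Qed.

Lemma ext_linear n : linear (@ext n).
Proof.
move=> k f g /=; apply/funext => xs; rewrite /ext !fctE.
by case: insub => //=; rewrite scaler0 addr0.
Qed.
Lemma extD n (f g : CR X A n) : ext (f + g) = ext f + ext g.
Proof. by have := ext_linear 1 f g; rewrite !scale1r. Qed.
Lemma ext0 n : ext (0 : CR X A n) = 0.
Proof. by apply/funext => xs; rewrite /ext; case: insub. Qed.
Lemma extZ n k (f : CR X A n) : ext (k *: f) = k *: ext f.
Proof. by have := ext_linear k f 0; rewrite ext0 !addr0. Qed.

Lemma ext_gcast m n (e : m = n) (f : CR X A m) : ext (gcast e f) = ext f.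
Proof. by case: n / e. Qed.

Lemma eps_ext n (f : CR X A n) : eps (ext f) = (-1) ^+ n *: ext f.
Proof.
apply/funext => xs; rewrite /eps fctE.
case: (eqVneq (size xs) n) => [->//|sn]; by rewrite supported_ext // !scaler0.
Qed.

Lemma shuffle_yE p q (s : 'S_(p + q)) (x : (p + q).-tuple X) x0 :
  tval (shuffle_y s x) = ypart x0 x (take p (word s)) (drop p (word s)).
Proof.
rewrite take_word drop_word /= /ypart -map_comp size_tuple.
apply: eq_map => k /=; rewrite -val_enum_ord filter_map foldr_map.
rewrite (tnth_nth x0); set u := nth _ _ _.
have -> : [seq i <- enum 'I_(p + q) | (i \in [set s (rshift p l) | l : 'I_q]) &&
             (i < s (lshift q k))%N] =
  [seq i <- enum 'I_(p + q) |
    preim val (fun i => (i \in [seq val (s (rshift p l)) | l <- enum 'I_q]) &&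
                        (i < s (lshift q k)))%N i].
  apply: eq_filter => i /=; congr andb; apply/imsetP/mapP => [[l _ ->]|[l _ e]].
    by exists l; rewrite ?mem_enum.
  by exists l => //; apply: val_inj.
by elim: (filter _ _) => //= i l ->; rewrite (tnth_nth x0).
Qed.

Lemma shuffle_zE p q (s : 'S_(p + q)) (x : (p + q).-tuple X) x0 :
  tval (shuffle_z s x) = zpart x0 x (drop p (word s)).
Proof.
rewrite drop_word /= /zpart -map_comp.
by apply: eq_map => k /=; rewrite (tnth_nth x0).
Qed.

Lemma ext_shuffle_prod t w p q (S : {set 'S_(p + q)})
    (f : CR X A p) (g : CR X A q) :
  (forall s, (s \in S) =
     hshuf_word t w (p + q) (take p (word s)) (drop p (word s))) ->
  ext (shuffle_prod S f g) = hshuf t w (ext f) (ext g).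
Proof.
move=> SE; apply: (@supported_eq (p + q)); first exact: supported_ext.
  by apply: supported_hshuf; apply: supported_ext.
move=> x; rewrite ext_tuple.
(* In degree 0 there may be no point to serve as a default. *)
case xE : (tval x) => [|x0 xs].
  case: p q S f g SE x xE => [|p] [|q] S f g SE x xE;
    try by have := size_tuple x; rewrite xE.
  have S0 (s : 'S_(0 + 0)) : s = 1%g by apply/permP => -[].
  rewrite /shuffle_prod big_mkcond (big_pred1 1%g) => [|s]; last first.
    by rewrite /= (S0 s) eqxx.
  rewrite SE /hshuf_word /= take0 word1 /=; case: w {SE} => //.
  rewrite odd_perm1 scale1r.
  by congr amul; apply: extE; exact: size0nil (size_tuple _).
rewrite -xE.
rewrite -(shuffle_sum_hshuf t w x0 (@supported_ext _ f) (@supported_ext _ g));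
  last by rewrite size_tuple.
have permE n : n = size x -> shuffle_sum t w p x0 (ext f) (ext g) x =
    \sum_(s : 'S_n | hshuf_word t w n (take p (word s)) (drop p (word s)))
    (-1) ^+ s *: amul (ext f (ypart x0 x (take p (word s)) (drop p (word s))))
                      (ext g (zpart x0 x (drop p (word s)))).
  by move->.
rewrite (permE (p + q)%N) ?size_tuple //; apply: eq_big => [s|s _]; first exact: SE.
by rewrite -shuffle_yE -shuffle_zE !ext_tuple.
Qed.

Lemma ext_rack_succ p q (f : CR X A p) (g : CR X A q) :
  ext (rack_succ f g) = hshuf false true (ext f) (ext g).
Proof. by apply: ext_shuffle_prod => s; apply: mem_shuffles_succ. Qed.

Lemma ext_rack_prec p q (f : CR X A p) (g : CR X A q) :
  ext (rack_prec f g) = hshuf true false (ext f) (ext g).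
Proof. by apply: ext_shuffle_prod => s; apply: mem_shuffles_prec. Qed.

(** The counterpart of [slice] on cochains. *)
Definition tslice n (y : X) (f : CR X A n.+1) : CR X A n :=
  fun x => f [tuple of y :: x].

Lemma ext_tslice n y (f : CR X A n.+1) : ext (tslice y f) = slice y (ext f).
Proof.
apply: (@supported_eq n); first exact: supported_ext.
  by apply: supported_slice; apply: supported_ext.
by move=> x; rewrite ext_tuple; apply: (extE f).
Qed.

Lemma rack_d0_ord0 n (f : CR X A n) y (ys : n.-tuple X) :
  rack_d0 ord0 f [tuple of y :: ys] = translate y (ext f) ys.
Proof.
apply: (extE f); apply: (@eq_from_nth _ y) => [|i]; rewrite !size_tuple // => ilt.
rewrite (nth_map y) ?size_tuple // -[i]/(val (Ordinal ilt)) -!tnth_nth.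
by rewrite tnth_mktuple /= tnth0 tnthS.
Qed.

Lemma rack_d1_ord0 n (f : CR X A n) y (ys : n.-tuple X) :
  rack_d1 ord0 f [tuple of y :: ys] = f ys.
Proof.
by congr f; apply: eq_from_tnth => j; rewrite tnth_mktuple tnthS.
Qed.

Lemma lift_lift0 n (i : 'I_n.+1) (k : 'I_n) :
  lift (lift ord0 i) (lift ord0 k) = lift ord0 (lift i k) :> 'I_n.+2.
Proof. by apply: val_inj; rewrite /= /bump !leq0n !add1n ltnS addnS. Qed.

Lemma rack_d1_lift0 n i (f : CR X A n.+1) y (ys : n.+1.-tuple X) :
  rack_d1 (lift ord0 i) f [tuple of y :: ys] = rack_d1 i (tslice y f) ys.
Proof.
congr f; apply: eq_from_tnth => j; rewrite tnth_mktuple.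
case: (unliftP ord0 j) => [k ->|->]; last by rewrite tnth0.
by rewrite tnthS tnth_mktuple lift_lift0 tnthS.
Qed.

Lemma rack_d0_lift0 n i (f : CR X A n.+1) y (ys : n.+1.-tuple X) :
  rack_d0 (lift ord0 i) f [tuple of y :: ys] = rack_d0 i (tslice y f) ys.
Proof.
congr f; apply: eq_from_tnth => j; rewrite tnth_mktuple.
case: (unliftP ord0 j) => [k ->|->]; last by rewrite tnth0.
rewrite !tnthS tnth_mktuple lift_lift0.
by rewrite tnthS /= /bump !leq0n !add1n ltnS.
Qed.

Lemma ext_rackD n (f : CR X A n) : ext (rackD X A n f) = list_d (ext f).
Proof.
apply: (@supported_eq n.+1); first exact: supported_ext.
  by apply: supported_list_d; apply: supported_ext.
move=> x; rewrite ext_tuple.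
have dE m (h : CR X A m) z : rack_d h z =
    \sum_(i < m.+1) (-1) ^+ i.+1 *: (rack_d0 i h z - rack_d1 i h z).
  by rewrite /rack_d fct_sumE.
elim: n f x => [|n IH] f x; case/tupleP: x => y ys.
  rewrite /= dE big_ord1 rack_d0_ord0 rack_d1_ord0 (tuple0 ys).
  rewrite (extE f (xs := [::])) //=.
  by rewrite /translate /= subrr !scaler0 subr0.
rewrite /= dE big_ord_recl rack_d0_ord0 rack_d1_ord0.
rewrite -ext_tslice -IH /= dE ext_tuple.
rewrite expr1 scaleN1r opprB; congr (_ + _); rewrite -sumrN; apply: eq_bigr => i _.
by rewrite rack_d0_lift0 rack_d1_lift0 /= /bump leq0n exprS mulN1r scaleNr.
Qed.

End Ext.

(** * Products induced on cohomology *)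

Section Cohomology.
Variables (K : comPzRingType) (C : nat -> lmodType K).
Variable d : forall n, {linear C n -> C n.+1}.

Lemma gcast0 m n (e : m = n) : gcast e (0 : C m) = 0.
Proof. by case: n / e. Qed.

Lemma cohclassP n (u : cohomology d n) :
  exists (x : C n) (dx : d n x = 0), u = cohclass dx.
Proof.
have [[x dx] ->] := to_quotmodP u; exists x, (eqP dx).
by congr to_quotmod; apply: val_inj.
Qed.

Lemma cohclass_eq n (x y : C n) (dx : d n x = 0) (dy : d n y = 0) :
  cohclass dx = cohclass dy <-> is_coboundary d (x - y).
Proof.
rewrite to_quotmodE; split; rewrite [_ \in _]unfold_in /coboundary /=.
  by move/asboolP.
by move=> h; apply/asboolP.
Qed.

Lemma is_coboundary0 n : is_coboundary d (0 : C n).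
Proof. by case: n => [//|n]; exists 0; rewrite linear0. Qed.

Lemma is_coboundaryD n (x y : C n) :
  is_coboundary d x -> is_coboundary d y -> is_coboundary d (x + y).
Proof.
case: n x y => [|n] x y /= => [-> ->|[u ->] [v ->]]; first by rewrite addr0.
by exists (u + v); rewrite linearD.
Qed.

Lemma is_coboundary_gcast m n (e : m = n) (x : C m) :
  is_coboundary d x -> is_coboundary d (gcast e x).
Proof. by case: n / e. Qed.

Lemma eq_cohclass n (x y : C n) (dx : d n x = 0) (dy : d n y = 0) :
  x = y -> cohclass dx = cohclass dy.
Proof.
by move=> xy; apply/cohclass_eq; rewrite xy subrr; apply: is_coboundary0.
Qed.

Lemma cocycleD n (x y : C n) : d n x = 0 -> d n y = 0 -> d n (x + y) = 0.
Proof. by move=> dx dy; rewrite linearD dx dy addr0. Qed.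
Lemma cocycleZ n k (x : C n) : d n x = 0 -> d n (k *: x) = 0.
Proof. by move=> dx; rewrite linearZ /= dx scaler0. Qed.
Lemma cocycle_gcast m n (e : m = n) (x : C m) : d m x = 0 -> d n (gcast e x) = 0.
Proof. by case: n / e. Qed.

Lemma cohclassD n (x y : C n) (dx : d n x = 0) (dy : d n y = 0) :
  cohclass dx + cohclass dy = cohclass (cocycleD dx dy).
Proof. by rewrite /cohclass -to_quotmodD; congr to_quotmod; apply: val_inj. Qed.

Lemma cohclassZ n k (x : C n) (dx : d n x = 0) :
  k *: cohclass dx = cohclass (cocycleZ k dx).
Proof.
rewrite [LHS]to_quotmodZ; congr to_quotmod; exact: val_inj.
Qed.

Lemma gcast_cohclass m n (e : m = n) (x : C m) (dx : d m x = 0) :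
  gcast e (cohclass dx) = cohclass (cocycle_gcast e dx).
Proof. by case: n / e; apply: eq_cohclass. Qed.

Section Product.
Variable m : gprod C.
Hypothesis m_linearl : forall p q (y : C q), linear (fun x : C p => m x y).
Hypothesis m_linearr : forall p q (x : C p), linear (m (p := p) (q := q) x).
Hypothesis m_leibniz : leibniz d m.

Lemma gprodBl p q (x x' : C p) (y : C q) : m (x - x') y = m x y - m x' y.
Proof. by rewrite addrC -scaleN1r m_linearl scaleN1r addrC. Qed.
Lemma gprodBr p q (x : C p) (y y' : C q) : m x (y - y') = m x y - m x y'.
Proof. by rewrite addrC -scaleN1r m_linearr scaleN1r addrC. Qed.
Lemma gprod0l p q (y : C q) : m (0 : C p) y = 0.
Proof. by rewrite -(subrr (0 : C p)) gprodBl subrr. Qed.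
Lemma gprod0r p q (x : C p) : m x (0 : C q) = 0.
Proof. by rewrite -(subrr (0 : C q)) gprodBr subrr. Qed.

Lemma cocycle_gprod p q (x : C p) (y : C q) :
  d p x = 0 -> d q y = 0 -> d _ (m x y) = 0.
Proof.
by move=> dx dy; rewrite m_leibniz dx dy gprod0l gprod0r gcast0 scaler0 addr0.
Qed.

Lemma coboundary_gprodl p q (x : C p) (y : C q) :
  is_coboundary d x -> d q y = 0 -> is_coboundary d (m x y).
Proof.
case: p x => [|p] x /= => [-> _|[w ->] dy].
  by rewrite gprod0l; apply: is_coboundary0.
by exists (m w y); rewrite m_leibniz dy gprod0r gcast0 scaler0 addr0.
Qed.

Lemma coboundary_gprodr p q (x : C p) (y : C q) :
  d p x = 0 -> is_coboundary d y -> is_coboundary d (m x y).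
Proof.
case: q y => [|q] y /= => [_ ->|dx [w ->]].
  by rewrite gprod0r; apply: is_coboundary0.
have -> : m x (d q w) = gcast (esym (addnS p q)) (d _ ((-1) ^+ p *: m x w)).
  rewrite linearZ /= m_leibniz dx gprod0l add0r scalerA -exprD addnn.
  rewrite -signr_odd odd_double scale1r.
  by move: (m x (d q w)); case: _ / (addnS p q).
by apply: is_coboundary_gcast; exists ((-1) ^+ p *: m x w).
Qed.

(** The product on cohomology: the class of the product of representatives, which
    are picked by the axiom of choice. *)
Definition cohprod : gprod (cohomology d) := fun p q u v =>
  let: exist x hx := cid (cohclassP u) in let: exist dx _ := cid hx in
  let: exist y hy := cid (cohclassP v) in let: exist dy _ := cid hy in
  cohclass (cocycle_gprod dx dy).

Lemma cohprodE p q (x : C p) (y : C q) (dx : d p x = 0) (dy : d q y = 0) :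
  cohprod (cohclass dx) (cohclass dy) = cohclass (cocycle_gprod dx dy).
Proof.
rewrite /cohprod; case: cid => x' hx; case: cid => dx' /esym/cohclass_eq xx'.
case: cid => y' hy; case: cid => dy' /esym/cohclass_eq yy'.
apply/cohclass_eq.
have -> : m x' y' - m x y = m (x' - x) y' + m x (y' - y).
  by rewrite gprodBl gprodBr addrA subrK.
by apply: is_coboundaryD; [apply: coboundary_gprodl | apply: coboundary_gprodr].
Qed.

Lemma cohprod_induces : induces m cohprod.
Proof. by move=> p q x y dx dy; exists (cocycle_gprod dx dy); apply: cohprodE. Qed.

Lemma cohprod_linearl p q (v : cohomology d q) :
  linear (fun u : cohomology d p => cohprod u v).
Proof.
move=> k u u' /=; have [x [dx ->]] := cohclassP u.
have [x' [dx' ->]] := cohclassP u'.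
have [y [dy ->]] := cohclassP v.
rewrite !(cohclassZ, cohclassD, cohprodE); by apply: eq_cohclass; exact: m_linearl.
Qed.

Lemma cohprod_linearr p q (u : cohomology d p) : linear (@cohprod p q u).
Proof.
move=> k v v' /=; have [x [dx ->]] := cohclassP u.
have [y' [dy' ->]] := cohclassP v'.
have [y [dy ->]] := cohclassP v.
rewrite !(cohclassZ, cohclassD, cohprodE); by apply: eq_cohclass; exact: m_linearr.
Qed.

End Product.

Theorem dendriform_cohomology (succ prec : gprod C) :
  is_dg_dendriform d succ prec ->
  exists succH precH : gprod (cohomology d),
    is_graded_dendriform succH precH /\
    induces succ succH /\ induces prec precH.
Proof.
case=> -[sl sr pl pr ss sp pp] _ sL pL.
exists (cohprod sl sr sL), (cohprod pl pr pL).
split; last by split; apply: cohprod_induces.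
split; [exact: cohprod_linearl|exact: cohprod_linearr
       |exact: cohprod_linearl|exact: cohprod_linearr| | |] => p q r u v w;
  have [x [dx ->]] := cohclassP u; have [y [dy ->]] := cohclassP v;
  have [z [dz ->]] := cohclassP w;
  rewrite !(cohprodE, cohclassD, gcast_cohclass); apply: eq_cohclass.
- exact: ss.
- exact: sp.
- exact: pp.
Qed.

End Cohomology.

(** * The rack cochain complex *)

Lemma rack_dg_dendriform (K : comPzRingType) (X : rack) (A : assocAlg K) :
  is_dg_dendriform (rackD X A) (@rack_succ K X A) (@rack_prec K X A).
Proof.
have ext_simp := (@ext_rack_succ K X A, @ext_rack_prec K X A, @extD K X A,
  @extZ K X A, @ext_gcast K X A, @ext_rackD K X A).
have bilin (p q : nat) t w (m : forall f : CR X A p, CR X A q -> CR X A (p + q)%N) :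
    (forall f g, ext (m f g) = hshuf t w (ext f) (ext g)) ->
    (forall g, linear (m^~ g)) /\ (forall f, linear (m f)).
  move=> mE; split=> [g|f] k h h' /=; apply: ext_inj;
    by rewrite !(ext_simp, mE) (hshuf_linearl, hshuf_linearr).
have leib t w (m : gprod (CR X A)) :
    (forall p q f g, ext (@m p q f g) = hshuf t w (ext f) (ext g)) ->
    leibniz (rackD X A) m.
  move=> mE p q f g; apply: ext_inj.
  rewrite !(ext_simp, mE) (list_d_hshuf t w w w) eps_ext.
  by rewrite hshufZl (mE p.+1 q) ext_rackD.
split; first split.
- by move=> p q; apply: (bilin p q _ _ _ (@ext_rack_succ _ _ _ _ _)).1.
- by move=> p q; apply: (bilin p q _ _ _ (@ext_rack_succ _ _ _ _ _)).2.
- by move=> p q; apply: (bilin p q _ _ _ (@ext_rack_prec _ _ _ _ _)).1.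
- by move=> p q; apply: (bilin p q _ _ _ (@ext_rack_prec _ _ _ _ _)).2.
- move=> p q r f g h; apply: ext_inj.
  by rewrite !ext_simp (hshuf_succ_succ _ _ true) hshufDl.
- by move=> p q r f g h; apply: ext_inj; rewrite !ext_simp; apply: hshuf_succ_prec.
- move=> p q r f g h; apply: ext_inj.
  by rewrite !ext_simp (hshuf_prec_prec _ _ true) hshufDr addrC.
- by move=> n f; apply: ext_inj; rewrite !ext_simp list_d_list_d ext0.
- by apply: leib => p q f g; apply: ext_rack_succ.
- by apply: leib => p q f g; apply: ext_rack_prec.
Qed.

Theorem theorem4p5 (K : comPzRingType) (X : rack) (A : assocAlg K) :
  is_dg_dendriform (rackD X A) (@rack_succ K X A) (@rack_prec K X A) /\
  exists succH precH : gprod (HR X A),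
    is_graded_dendriform succH precH /\
    induces (d := rackD X A) (@rack_succ K X A) succH /\
    induces (d := rackD X A) (@rack_prec K X A) precH.
Proof.
split; first exact: rack_dg_dendriform.
exact: dendriform_cohomology (rack_dg_dendriform X A).
Qed.
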